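(* Second-order multi-agent systems with bounded actuation cannot achieve connectivity-preserving consensus from arbitrary initial states. Specifically, consider two agents $\ddot x_i=f_i$, $x_i\in\mathbb{R}$, $i=1,2$, with communication radius $r>0$ and actuation bounds $|f_i(t)|\le\bar f_i$, where $\bar f_1,\bar f_2>0$. Let $0<\epsilon<r$, and let the initial state satisfy $x_2(0)-x_1(0)=r-\epsilon$ and $\dot x_2(0)-\dot x_1(0)=\sqrt{3\epsilon(\bar f_1+\bar f_2)}$. Then for every choice of (measurable) controls $f_1,f_2$ obeying the actuation bounds there is a time $t>0$ with $x_2(t)-x_1(t)=r$. Hence no controller maintains $|x_2(t)-x_1(t)|<r$ for all $t\ge0$, so no controller drives this system to consensus while preserving its initial connectivity.
   Context: Two agents can communicate only while their distance is strictly less than the communication radius $r$. The two agents are initially adjacent. Connectivity-preserving consensus means $|x_2(t)-x_1(t)|<r$ for all $t\ge0$ and $x_2(t)-x_1(t)\to0$ as $t\to\infty$. *)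

(* Defs.v *)
From HB Require Import structures.
From mathcomp Require Import all_boot all_order all_algebra.
From mathcomp Require Import all_classical all_reals all_analysis.

Set Implicit Arguments.
Unset Strict Implicit.
Unset Printing Implicit Defensive.

Import Order.TTheory GRing.Theory Num.Theory.
Import numFieldNormedType.Exports.

Local Open Scope classical_set_scope.
Local Open Scope ring_scope.

(* Time signals are functions R -> R of which only the values on [0, +oo[
   matter. *)

Definition admissible_control {R : realType} (fbar : R) (f : R -> R) : Prop :=
  measurable_fun (`[0, +oo[ : set R) f /\
  forall t : R, 0 <= t -> `|f t| <= fbar.

(* x is a Caratheodory solution of x'' = f on [0, +oo[ with velocity v = x'.
   As f is only measurable, v' = f is taken in integrated form.  The integral
   is meaningful for admissible f (bounded, measurable), and then v is
   continuous; hence, x being continuous at 0, v 0 is its right derivative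
   there. *)
Definition double_integrator {R : realType} (f x v : R -> R) : Prop :=
  [/\ {within `[0, +oo[, continuous x},
      forall t : R, 0 < t -> is_derive t 1 x (v t) &
      forall t : R, 0 <= t ->
        v t = v 0 + \int[lebesgue_measure]_(s in `[0, t]) f s].

Definition two_agents {R : realType} (fbar1 fbar2 : R)
    (f1 f2 x1 v1 x2 v2 : R -> R) : Prop :=
  [/\ admissible_control fbar1 f1, admissible_control fbar2 f2,
      double_integrator f1 x1 v1 & double_integrator f2 x2 v2].

Definition initial_state {R : realType} (p1 w1 p2 w2 : R)
    (x1 v1 x2 v2 : R -> R) : Prop :=
  [/\ x1 0 = p1, v1 0 = w1, x2 0 = p2 & v2 0 = w2].

Definition preserves_connectivity {R : realType} (r : R)
    (x1 x2 : R -> R) : Prop :=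
  forall t : R, 0 <= t -> `|x2 t - x1 t| < r.

Definition connectivity_preserving_consensus {R : realType} (r : R)
    (x1 x2 : R -> R) : Prop :=
  preserves_connectivity r x1 x2 /\ (x2 t - x1 t) @[t --> +oo] --> (0 : R).

(* Some controller within the actuation bounds produces, from the given
   initial state, a motion whose positions satisfy P.  The controls are
   arbitrary open-loop signals: the closed-loop motion of any feedback law is
   the motion driven by the signals that the law generates along it. *)
Definition achievable {R : realType} (fbar1 fbar2 p1 w1 p2 w2 : R)
    (P : (R -> R) -> (R -> R) -> Prop) : Prop :=
  exists f1 f2 x1 v1 x2 v2 : R -> R,
    [/\ two_agents fbar1 fbar2 f1 f2 x1 v1 x2 v2,
        initial_state p1 w1 p2 w2 x1 v1 x2 v2 & P x1 x2].

(* Main.v *)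
Require Import Defs.
From HB Require Import structures.
From mathcomp Require Import all_boot all_order all_algebra.
From mathcomp Require Import all_classical all_reals all_analysis.
From mathcomp Require Import ring lra.

Set Implicit Arguments.
Unset Strict Implicit.
Unset Printing Implicit Defensive.

Import Order.TTheory GRing.Theory Num.Theory.
Import numFieldNormedType.Exports.

Local Open Scope classical_set_scope.
Local Open Scope ring_scope.

(** The relative position [d = x2 - x1] has initial velocity [w] and
acceleration at least [- F], where [F = fbar1 + fbar2].  Hence its velocity is
at least [w - F * t], and [d t >= d 0 + w * t - F / 2 * t ^+ 2].  The right-hand
side is largest at the full-braking time [t = w / F], where it equals
[d 0 + w ^+ 2 / (2 * F)].  With [d 0 = r - eps] and [w ^+ 2 = 3 * eps * F] this
is [r + eps / 2 > r], so the continuous function [d] crosses [r] by the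
intermediate value theorem.  A motion with [d t = r] does not preserve
connectivity, and [eps = r / 2] provides an initially connected state from which
consensus is impossible.

[admissible_integral_bound] gives the velocity estimate, [quadratic_minorant]
the position estimate, and [relative_position_reaches_radius] the crossing. *)

Lemma admissible_integral_bound (R : realType) (fbar : R) (f : R -> R) (t : R) :
  admissible_control fbar f -> 0 <= t ->
  `|\int[lebesgue_measure]_(s in `[0, t]) f s| <= fbar * t.
Proof.
move=> [mf bf] t0.
have mu_t : lebesgue_measure (`[0, t]%classic : set R) = t%:E.
  rewrite lebesgue_measure_itv/= lte_fin; case: ltgtP t0 => //= [_|<-] _ //.
  by rewrite oppr0 adde0.
have fin_t : (lebesgue_measure (`[0%R, t]%classic : set R) < +oo)%E.
  by rewrite mu_t ltry.
have mt : measurable_fun (`[0, t] : set R) f.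
  apply: measurable_funS mf => //.
  by move=> s /=; rewrite !in_itv/= => /andP[->].
have f_le s : `[0, t]%classic s -> `|f s| <= fbar.
  by rewrite /= in_itv/= => /andP[s0 _]; exact: bf.
have int_f : lebesgue_measure.-integrable (`[0, t]%classic : set R) (EFin \o f).
  apply: measurable_bounded_integrable => //.
  exists fbar; split; first exact: num_real.
  by move=> M fbarM s /f_le fs /=; exact: le_trans fs (ltW fbarM).
apply: le_trans (le_normr_Rintegral _ int_f) _ => //.
have -> : fbar * t = \int[lebesgue_measure]_(s in `[0, t]) fbar.
  by rewrite Rintegral_cst//= mu_t.
apply: le_Rintegral => //.
- apply: measurable_bounded_integrable => //; first exact: measurableT_comp.
  exists fbar; split; first exact: num_real.
  move=> M fbarM s /f_le fs /=; rewrite normr_id.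
  exact: le_trans fs (ltW fbarM).
- apply: measurable_bounded_integrable => //.
  exists `|fbar|; split; first exact: num_real.
  by move=> M fbarM s _ /=; exact: ltW.
Qed.

Lemma quadratic_minorant (R : realType) (d dd : R -> R) (w F t : R) :
  {within `[0, +oo[, continuous d} ->
  (forall s : R, 0 < s -> is_derive s 1 d (dd s)) ->
  (forall s : R, 0 <= s -> w - F * s <= dd s) ->
  0 <= t -> d 0 + w * t - F / 2 * t ^+ 2 <= d t.
Proof.
move=> cd dd_d dd_ge t0.
pose q := fun s : R => w * s - F / 2 * s ^+ 2.
have dq (s : R) : is_derive s 1 q (w - F * s).
  rewrite /q; apply: is_derive_eq.
  by rewrite /GRing.scale/=; field.
have cq : continuous q.
  by move=> s; apply: differentiable_continuous; apply/derivable1_diffP.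
have [||c + dE] := @MVT_segment R (fun s => d s - q s)
    (fun s => dd s - (w - F * s)) 0 t t0.
- move=> s; rewrite in_itv/= => /andP[s0 _].
  have ds := dd_d _ s0.
  exact: is_deriveB.
- have cdt : {within `[0, t], continuous d}.
    apply: continuous_subspaceW cd.
    by move=> s /=; rewrite !in_itv/= => /andP[->].
  move=> s; apply: continuousB; first exact: cdt.
  exact: (continuous_subspaceT cq).
rewrite in_itv/= => /andP[c0 ct].
have : 0 <= (dd c - (w - F * c)) * (t - 0).
  by rewrite mulr_ge0// ?subr0// subr_ge0 dd_ge.
rewrite -dE /q; lra.
Qed.

Lemma relative_position_reaches_radius (R : realType) (r F eps w : R)
    (d dd : R -> R) :
  0 < eps -> 0 < F -> d 0 = r - eps -> w = Num.sqrt (3 * eps * F) ->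
  {within `[0, +oo[, continuous d} ->
  (forall s : R, 0 < s -> is_derive s 1 d (dd s)) ->
  (forall s : R, 0 <= s -> w - F * s <= dd s) ->
  exists t, 0 < t /\ d t = r.
Proof.
move=> eps0 F0 d0 wE cd dd_d dd_ge.
have w2 : w ^+ 2 = 3 * eps * F by rewrite wE sqr_sqrtr//; nra.
have T0 : 0 <= w / F by rewrite divr_ge0 ?wE ?sqrtr_ge0// ltW.
(* [w / F] is the time at which full braking stops the relative motion. *)
have dT : r < d (w / F).
  apply: lt_le_trans (quadratic_minorant cd dd_d dd_ge T0).
  have -> : d 0 + w * (w / F) - F / 2 * (w / F) ^+ 2 = d 0 + w ^+ 2 / (2 * F).
    by field; rewrite gt_eqF.
  have -> : w ^+ 2 / (2 * F) = 3 / 2 * eps.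
    by rewrite w2; field; rewrite gt_eqF.
  rewrite d0; lra.
have [|||t] := @IVT R d 0 (w / F) r => //.
- apply: continuous_subspaceW cd.
  by move=> s /=; rewrite !in_itv/= => /andP[->].
- by rewrite ge_min le_max d0 (ltW dT) orbT andbT; apply/orP; left; lra.
rewrite in_itv/= => /andP[t0 _] dt; exists t; split => //.
rewrite lt_neqAle t0 andbT; apply/eqP => t_0.
by move: dt; rewrite -t_0 d0; lra.
Qed.

Lemma two_agents_reach_radius (R : realType) (r fbar1 fbar2 eps p1 w1 p2 w2 : R)
    (f1 f2 x1 v1 x2 v2 : R -> R) :
  0 < eps -> 0 < fbar1 + fbar2 ->
  p2 - p1 = r - eps ->
  w2 - w1 = Num.sqrt (3 * eps * (fbar1 + fbar2)) ->
  two_agents fbar1 fbar2 f1 f2 x1 v1 x2 v2 ->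
  initial_state p1 w1 p2 w2 x1 v1 x2 v2 ->
  exists t : R, 0 < t /\ x2 t - x1 t = r.
Proof.
move=> eps0 F0 p21 w21 [a1 a2 [cx1 dx1 v1E] [cx2 dx2 v2E]] [x10 v10 x20 v20].
apply: (@relative_position_reaches_radius R r (fbar1 + fbar2) eps (w2 - w1)
  (fun t => x2 t - x1 t) (fun t => v2 t - v1 t)) => //.
- by rewrite x10 x20.
- by move=> s; apply: continuousB; [exact: cx2|exact: cx1].
- move=> s s0; have := dx1 _ s0; have := dx2 _ s0 => ? ?.
  exact: is_deriveB.
- move=> s s0; rewrite (v1E _ s0) (v2E _ s0) v10 v20.
  have := admissible_integral_bound a1 s0; rewrite ler_norml => /andP[_ +].
  have := admissible_integral_bound a2 s0; rewrite ler_norml => /andP[+ _].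
  lra.
Qed.

Theorem mainTheorem4 (R : realType) (r fbar1 fbar2 : R)
    (r_gt0 : 0 < r) (fbar1_gt0 : 0 < fbar1) (fbar2_gt0 : 0 < fbar2) :
  ~ (forall p1 w1 p2 w2 : R, `|p2 - p1| < r ->
       achievable fbar1 fbar2 p1 w1 p2 w2
         (connectivity_preserving_consensus r)) /\
  (forall eps p1 w1 p2 w2 : R,
     0 < eps -> eps < r ->
     p2 - p1 = r - eps ->
     w2 - w1 = Num.sqrt (3 * eps * (fbar1 + fbar2)) ->
     [/\ forall f1 f2 x1 v1 x2 v2 : R -> R,
           two_agents fbar1 fbar2 f1 f2 x1 v1 x2 v2 ->
           initial_state p1 w1 p2 w2 x1 v1 x2 v2 ->
           exists t : R, 0 < t /\ x2 t - x1 t = r,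
         ~ achievable fbar1 fbar2 p1 w1 p2 w2 (preserves_connectivity r) &
         ~ achievable fbar1 fbar2 p1 w1 p2 w2
             (connectivity_preserving_consensus r)]).
Proof.
have F0 : 0 < fbar1 + fbar2 by exact: addr_gt0.
have lost eps p1 w1 p2 w2 : 0 < eps -> p2 - p1 = r - eps ->
    w2 - w1 = Num.sqrt (3 * eps * (fbar1 + fbar2)) ->
    ~ achievable fbar1 fbar2 p1 w1 p2 w2 (preserves_connectivity r).
  move=> eps0 p21 w21 [f1 [f2 [x1 [v1 [x2 [v2 [sys ini conn]]]]]]].
  have [t [t0 dt]] := two_agents_reach_radius eps0 F0 p21 w21 sys ini.
  by have := conn _ (ltW t0); rewrite dt gtr0_norm// ltxx.
have achievable_connectivity p1 w1 p2 w2 :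
    achievable fbar1 fbar2 p1 w1 p2 w2 (connectivity_preserving_consensus r) ->
    achievable fbar1 fbar2 p1 w1 p2 w2 (preserves_connectivity r).
  move=> [f1 [f2 [x1 [v1 [x2 [v2 [sys ini [conn _]]]]]]]].
  by exists f1, f2, x1, v1, x2, v2.
split.
  (* Initial state with [eps = r / 2] and the first agent at rest at [0]. *)
  move=> /(_ 0 0 (r / 2) (Num.sqrt (3 * (r / 2) * (fbar1 + fbar2)))).
  rewrite subr0 gtr0_norm ?divr_gt0// => /(_ _)/achievable_connectivity.
  have r2 : r / 2 < r by lra.
  move=> /(_ r2); apply: (@lost (r / 2)).
  - by rewrite divr_gt0.
  - lra.
  - by rewrite subr0.
move=> eps p1 w1 p2 w2 eps0 eps_r p21 w21; split.
- by move=> f1 f2 x1 v1 x2 v2; exact: two_agents_reach_radius p21 w21.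
- exact: lost p21 w21.
- by move/achievable_connectivity; exact: lost p21 w21.
Qed.
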